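(* Let $G$ and $H$ be finite, simple, connected, bipartite graphs with $|V(G)|>1$, $|V(H)|>1$, and bipartitions $V(G)=A_G\cup B_G$ and $V(H)=A_H\cup B_H$. If $\delta(G)\ne\delta(H)$, then at least one of the following holds: (i) there exist a minimum dominating set $D$ of $G$ and $X\in\{A_G,B_G\}$ such that $|D\cap X|/|X|>\delta(H)$; (ii) there exist a minimum dominating set $D'$ of $H$ and $Y\in\{A_H,B_H\}$ such that $|D'\cap Y|/|Y|>\delta(G)$.
   Context: $\gamma(G)$ is the domination number of $G$, i.e. the minimum cardinality of a dominating set of $G$ (a set $D\subseteq V(G)$ such that every vertex is in $D$ or adjacent to a vertex of $D$). A minimum dominating set is a dominating set of cardinality $\gamma(G)$. The domination density is $\delta(G):=\gamma(G)/|V(G)|$ (so $\delta$ does not denote minimum degree). *)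

(* Defs.v *)
From mathcomp Require Import all_boot all_order all_algebra.

Set Implicit Arguments.
Unset Strict Implicit.
Unset Printing Implicit Defensive.

Import Order.TTheory GRing.Theory Num.Theory.

Record sgraph := SGraph {
  vertex :> finType;
  adj : rel vertex;
  adj_sym : symmetric adj;
  adj_irrefl : irreflexive adj
}.

(* The empty graph satisfies this predicate, so theorems about connected graphs
   must exclude it by a separate hypothesis on the order. *)
Definition connected (G : sgraph) : Prop :=
  forall x y : G, connect (@adj G) x y.

Definition independent (G : sgraph) (S : {set G}) : bool :=
  [forall x in S, forall y in S, ~~ adj x y].

(* The two parts are not required to be nonempty. *)
Definition bipartition (G : sgraph) (A B : {set G}) : Prop :=
  [/\ A :|: B = [set: G], A :&: B = set0, independent A & independent B].

Definition dominating (G : sgraph) (D : {set G}) : bool :=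
  [forall x, (x \in D) || [exists y in D, adj x y]].

(* [arg min] is meaningful because the full vertex set is dominating. *)
Definition domination_number (G : sgraph) : nat :=
  #|[arg min_(D < [set: G] | dominating D) #|D|]|.

Definition min_dominating (G : sgraph) (D : {set G}) : bool :=
  dominating D && (#|D| == domination_number G).

Definition domination_density (G : sgraph) : rat :=
  ((domination_number G)%:R / #|G|%:R)%R.

Lemma dominatingT (G : sgraph) : dominating [set: G].
Proof. by apply/forallP => x; rewrite in_setT. Qed.

Lemma domination_number_min (G : sgraph) (D : {set G}) :
  dominating D -> domination_number G <= #|D|.
Proof.
rewrite /domination_number; case: arg_minnP; first exact: dominatingT.
by move=> E _ minE /minE.
Qed.

Lemma min_dominating_exists (G : sgraph) : exists D : {set G}, min_dominating D.
Proof.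
exists [arg min_(D < [set: G] | dominating D) #|D|].
rewrite /min_dominating eqxx andbT.
by case: arg_minnP; first exact: dominatingT.
Qed.

(* Main.v *)
Require Import Defs.
From mathcomp Require Import all_boot all_order all_algebra.

Set Implicit Arguments.
Unset Strict Implicit.
Unset Printing Implicit Defensive.

Import Order.TTheory GRing.Theory Num.Theory.

(** The domination density of a graph is a weighted average of the densities
    that a minimum dominating set has on the two sides of a bipartition, with
    weights proportional to the sizes of the sides. An average never exceeds
    all of the averaged terms, so in the graph of larger domination density
    every minimum dominating set is denser than the other graph's domination
    density on at least one side. *)

(** If [S] had at most [c * #|X|] elements in each part [X], adding the two
    bounds would give at most [c * #|T|] elements in all. An empty part cannot
    be the dense one, so the junk value of the quotient [0 / 0] is harmless. *)
Lemma dense_on_some_part (T : finType) (S A B : {set T}) (c : rat) :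
  A :|: B = [set: T] -> A :&: B = set0 ->
  (c * #|T|%:R < #|S|%:R)%R ->
  exists2 X : {set T}, X = A \/ X = B & (c < #|S :&: X|%:R / #|X|%:R)%R.
Proof.
move=> AB_cover AB_disj dense_S.
have dense_part (X : {set T}) : (c * #|X|%:R < #|S :&: X|%:R)%R ->
    (c < #|S :&: X|%:R / #|X|%:R)%R.
  case: (posnP #|X|) => [/cards0_eq-> | X_gt0].
    by rewrite setI0 cards0 mulr0 ltxx.
  by rewrite ltr_pdivlMr // ltr0n.
have card_T : #|T| = #|A| + #|B|.
  by rewrite -cardsUI AB_disj cards0 addn0 AB_cover cardsT.
have card_S : #|S| = #|S :&: A| + #|S :&: B|.
  by rewrite -cardsUI -setIUr -setIIr AB_cover AB_disj setIT setI0 cards0 addn0.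
have [/dense_part dense_A | sparse_A] :=
  ltP (c * #|A|%:R)%R #|S :&: A|%:R%R; first by exists A; first left.
have [/dense_part dense_B | sparse_B] :=
  ltP (c * #|B|%:R)%R #|S :&: B|%:R%R; first by exists B; first right.
by move: dense_S; rewrite card_S card_T !natrD mulrDr ltNge lerD.
Qed.

Lemma min_dominating_dense_on_part (G : sgraph) (A B : {set G}) (c : rat) :
  0 < #|G| -> bipartition A B -> (c < domination_density G)%R ->
  exists D X : {set G},
    [/\ min_dominating D, X = A \/ X = B & (c < #|D :&: X|%:R / #|X|%:R)%R].
Proof.
move=> G_gt0 [AB_cover AB_disj _ _] lt_c.
have [D minD] := min_dominating_exists G.
have [|X partX dense_X] := dense_on_some_part (S := D) (c := c) AB_cover AB_disj.
  have /andP[_ /eqP->] := minD.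
  by rewrite -ltr_pdivlMr // ltr0n.
by exists D, X.
Qed.

Theorem corollary3 (G H : sgraph) (AG BG : {set G}) (AH BH : {set H}) :
  connected G -> connected H ->
  1 < #|G| -> 1 < #|H| ->
  bipartition AG BG -> bipartition AH BH ->
  domination_density G <> domination_density H ->
  (exists (D X : {set G}),
     [/\ min_dominating D, X = AG \/ X = BG
       & (domination_density H < #|D :&: X|%:R / #|X|%:R)%R]) \/
  (exists (D' Y : {set H}),
     [/\ min_dominating D', Y = AH \/ Y = BH
       & (domination_density G < #|D' :&: Y|%:R / #|Y|%:R)%R]).
Proof.
move=> _ _ G_gt1 H_gt1 bipG bipH /eqP; rewrite neq_lt => /orP[ltGH | ltHG].
  by right; apply: min_dominating_dense_on_part ltGH; first exact: ltnW.
by left; apply: min_dominating_dense_on_part ltHG; first exact: ltnW.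
Qed.
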